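(* For every $\epsilon>0$ there is $L_0$ such that the following holds. Let $V$ be a distinguished positive vector such that $V/\|V\|$ lies in a loop level set of period $L>L_0$, and write $E(V)=(a,b,c)$. Then $0<b<2+\epsilon$.
   Context: $\mathrm{Sol}$ is $\mathbb{R}^3$ with metric $e^{-2z}dx^2+e^{2z}dy^2+dz^2$ and group law $(x,y,z)*(a,b,c)=(e^za+x,e^{-z}b+y,c+z)$; $E$ is the Riemannian exponential map at the origin (tangent space identified with $\mathbb{R}^3$). Let $\Sigma(x,y,z)=(xz,-yz,-x^2+y^2)$, a vector field tangent to the unit sphere $S^2$, with flow $\Phi_s$. For $V\ne0$ the flowline of $V$ is $s\mapsto\Phi_s(V/\|V\|)$, $s\in[0,\|V\|]$. A vector is positive if all three coordinates are positive. For $c\in(0,1/2)$, the set $\{(x,y,z)\in S^2: x,y>0,\ xy=c\}$ is a loop level set; it is a closed orbit of $\Phi$ and its period (time to go once around) is $L_\alpha=\pi/\mathrm{AGM}(\alpha,\tfrac12\sqrt{1+2\alpha^2})$ with $\alpha=\sqrt c$. A flowline is symmetric if its endpoints have the form $(p,q,w)$ and $(p,q,-w)$. A small symmetric flowline is a symmetric flowline of a vector $W$ with $W/\|W\|$ in a loop level set of period $L$ and $\|W\|<L$. A vector $V$ is distinguished if there is $\lambda\ge1$ such that the flowline of $\lambda V$ is a small symmetric flowline. *)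

(* Defs.v *)
From Stdlib Require Import Reals.
From Coquelicot Require Import Coquelicot.
Open Scope R_scope.

Definition norm3 (x y z : R) : R := sqrt (x ^ 2 + y ^ 2 + z ^ 2).

(* Graph of the Riemannian exponential map of Sol at the origin:
   sol_exp V1 V2 V3 a b c  means  E(V1,V2,V3) = (a,b,c), i.e. there is a
   geodesic t |-> (x t, y t, z t) of the metric e^{-2z}dx^2+e^{2z}dy^2+dz^2
   (with velocity (u,v,w)) starting at the origin with initial velocity V,
   and its value at time 1 is (a,b,c).  Geodesic equations:
     x'' = 2 x' z',  y'' = -2 y' z',  z'' = -e^{-2z} x'^2 + e^{2z} y'^2. *)
Definition sol_exp (V1 V2 V3 a b c : R) : Prop :=
  exists x y z u v w : R -> R,
    (forall t,
      is_derive x t (u t) /\ is_derive y t (v t) /\ is_derive z t (w t) /\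
      is_derive u t (2 * u t * w t) /\
      is_derive v t (- 2 * v t * w t) /\
      is_derive w t (- exp (- 2 * z t) * (u t) ^ 2 + exp (2 * z t) * (v t) ^ 2)) /\
    x 0 = 0 /\ y 0 = 0 /\ z 0 = 0 /\
    u 0 = V1 /\ v 0 = V2 /\ w 0 = V3 /\
    x 1 = a /\ y 1 = b /\ z 1 = c.

Definition sigma_curve (p q r : R -> R) : Prop :=
  forall t,
    is_derive p t (p t * r t) /\
    is_derive q t (- q t * r t) /\
    is_derive r t (- (p t) ^ 2 + (q t) ^ 2).

Definition symmetric_flowline (W1 W2 W3 : R) : Prop :=
  let n := norm3 W1 W2 W3 in
  exists p q r : R -> R,
    sigma_curve p q r /\
    p 0 = W1 / n /\ q 0 = W2 / n /\ r 0 = W3 / n /\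
    p n = p 0 /\ q n = q 0 /\ r n = - r 0.

Fixpoint agm_seq (a b : R) (n : nat) : R * R :=
  match n with
  | O => (a, b)
  | S m => let '(x, y) := agm_seq a b m in ((x + y) / 2, sqrt (x * y))
  end.

Definition AGM (a b : R) : R := real (Lim_seq (fun n => fst (agm_seq a b n))).

Definition loop_period (c : R) : R :=
  PI / AGM (sqrt c) (/ 2 * sqrt (1 + 2 * (sqrt c) ^ 2)).

Definition in_loop_level_set (x y z c : R) : Prop :=
  0 < c < / 2 /\ x ^ 2 + y ^ 2 + z ^ 2 = 1 /\ 0 < x /\ 0 < y /\ x * y = c.

Definition small_symmetric (W1 W2 W3 : R) : Prop :=
  let n := norm3 W1 W2 W3 in
  (W1, W2, W3) <> (0, 0, 0) /\
  (exists c, in_loop_level_set (W1 / n) (W2 / n) (W3 / n) c /\ n < loop_period c) /\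
  symmetric_flowline W1 W2 W3.

Definition distinguished (V1 V2 V3 : R) : Prop :=
  exists lam, 1 <= lam /\ small_symmetric (lam * V1) (lam * V2) (lam * V3).

Definition positive3 (V1 V2 V3 : R) : Prop := 0 < V1 /\ 0 < V2 /\ 0 < V3.

(* Main.v *)
Require Import Defs.
From Stdlib Require Import Reals Lra Psatz Arith Lia.
From Coquelicot Require Import Coquelicot.
Open Scope R_scope.

(* In the left-invariant frame a unit-speed geodesic is a flow line (p, q, r)
   of Sigma with q = q(0) e^{-z}, so b q(0) is the integral of q^2 along it.
   On the orbit p q = c write p - q = k sin X, r = k cos X; then
   X' = p + q = 2 sqrt (g^2 cos^2 X + h^2 sin^2 X) with g = sqrt c and
   h = sqrt (1 + 2 c) / 2, and Gauss' transformation shows that X needs time at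
   least pi / AGM(g, h) to gain 2 pi.  A small symmetric flow line is therefore
   the single arc from X(0) to pi - X(0).  Since r' = q^2 - p^2, on that arc
   the integral of q^2 is at most 2 (1 - r(0)) + O(c) when p(0) < q(0), and
   O(c) otherwise, which divided by q(0) is at most 2 + O(sqrt c).  Finally c
   is small when the period is large, and b increases with |V|. *)

(** * Monotonicity and constancy from derivatives *)

Lemma is_derive_continuity_pt (f : R -> R) (x l : R) :
  is_derive f x l -> continuity_pt f x.
Proof.
  intros H. apply continuity_pt_filterlim.
  apply (ex_derive_continuous f). now exists l.
Qed.

Lemma is_derive_nonpos_le (f df : R -> R) (a b : R) :
  a <= b ->
  (forall t, a <= t <= b -> is_derive f t (df t)) ->
  (forall t, a <= t <= b -> df t <= 0) ->
  f b <= f a.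
Proof.
  intros Hab Hf Hdf.
  destruct (MVT_gen f a b df) as [x [Hx Heq]].
  - intros x Hx. rewrite Rmin_left, Rmax_right in Hx by lra. apply Hf; lra.
  - intros x Hx. rewrite Rmin_left, Rmax_right in Hx by lra.
    apply is_derive_continuity_pt with (df x), Hf; lra.
  - rewrite Rmin_left, Rmax_right in Hx by lra.
    specialize (Hdf x Hx). nra.
Qed.

Lemma is_derive_pos_lt (f df : R -> R) (a b : R) :
  a < b ->
  (forall t, is_derive f t (df t)) ->
  (forall t, 0 < df t) ->
  f a < f b.
Proof.
  intros Hab Hf Hdf.
  destruct (MVT_gen f a b df) as [x [_ Heq]].
  - intros x _. apply Hf.
  - intros x _. apply is_derive_continuity_pt with (df x), Hf.
  - specialize (Hdf x). nra.
Qed.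

Lemma is_derive_zero_const (f : R -> R) :
  (forall t, is_derive f t 0) -> forall t, f t = f 0.
Proof.
  intros Hf t.
  destruct (MVT_gen f 0 t (fun _ => 0)) as [x [_ Heq]].
  - intros x _. apply Hf.
  - intros x _. apply is_derive_continuity_pt with 0, Hf.
  - lra.
Qed.

(** [auto_derive] leaves [Derive] terms that match the derivative hypotheses only up to conversion,
    hence the [change] before each rewrite. *)
Ltac derive_from_hyps :=
  cbv beta; auto_derive;
  [ repeat split; try (eexists; eassumption); try exact I
  | repeat match goal with
           | H : is_derive ?f ?t _ |- context [Derive ?g ?s] =>
               change (Derive g s) with (Derive f t);
               rewrite (is_derive_unique f t _ H)
           end ].

(** * First integrals and uniqueness for the flow of Sigma *)

Lemma sigma_norm_const (p q r : R -> R) :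
  sigma_curve p q r ->
  forall t, p t ^ 2 + q t ^ 2 + r t ^ 2 = p 0 ^ 2 + q 0 ^ 2 + r 0 ^ 2.
Proof.
  intros H.
  apply (is_derive_zero_const (fun t => p t ^ 2 + q t ^ 2 + r t ^ 2)).
  intros t. destruct (H t) as [Hp [Hq Hr]].
  derive_from_hyps. ring.
Qed.

Lemma sigma_prod_const (p q r : R -> R) :
  sigma_curve p q r -> forall t, p t * q t = p 0 * q 0.
Proof.
  intros H.
  apply (is_derive_zero_const (fun t => p t * q t)).
  intros t. destruct (H t) as [Hp [Hq Hr]].
  derive_from_hyps. ring.
Qed.

(* Gronwall for the squared distance [D] of two unit solutions: [D' <= 4 D]. *)
Lemma sigma_unique (p q r p' q' r' : R -> R) :
  sigma_curve p q r -> sigma_curve p' q' r' ->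
  p 0 ^ 2 + q 0 ^ 2 + r 0 ^ 2 = 1 ->
  p' 0 = p 0 -> q' 0 = q 0 -> r' 0 = r 0 ->
  forall t, 0 <= t -> p' t = p t /\ q' t = q t /\ r' t = r t.
Proof.
  intros H H' Hn Hp0 Hq0 Hr0 t Ht.
  set (D := fun s => (p' s - p s) ^ 2 + (q' s - q s) ^ 2 + (r' s - r s) ^ 2).
  assert (HD : exp (- 4 * t) * D t <= exp (- 4 * 0) * D 0).
  (* The terms of [D'] that are cubic in the differences cancel; the remaining coefficients [p],
     [q], [r] are at most 1 in absolute value on the unit sphere. *)
  { apply (is_derive_nonpos_le (fun s => exp (- 4 * s) * D s)
      (fun s => exp (- 4 * s) *
        (- 4 * D s + 2 * (r s * ((p' s - p s) ^ 2 - (q' s - q s) ^ 2)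
          - p s * ((p' s - p s) * (r' s - r s))
          + q s * ((q' s - q s) * (r' s - r s)))))); trivial.
    - intros s _. destruct (H s) as [Hp [Hq Hr]].
      destruct (H' s) as [Hp' [Hq' Hr']].
      unfold D. derive_from_hyps. ring.
    - intros s _. pose proof (exp_pos (- 4 * s)) as He.
      pose proof (sigma_norm_const p q r H s) as Hs. rewrite Hn in Hs.
      assert (-1 <= r s <= 1) by nra.
      assert (-1 <= p s <= 1) by nra.
      assert (-1 <= q s <= 1) by nra.
      unfold D.
      set (x := p' s - p s). set (y := q' s - q s). set (z := r' s - r s).
      assert (r s * (x ^ 2 - y ^ 2) <= x ^ 2 + y ^ 2) by nra.
      assert (- p s * (x * z) <= (x ^ 2 + z ^ 2) / 2).
      { assert (0 <= (1 - p s ^ 2) * z ^ 2)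
          by (apply Rmult_le_pos; nra).
        pose proof (pow2_ge_0 (x + p s * z)). nra. }
      assert (q s * (y * z) <= (y ^ 2 + z ^ 2) / 2).
      { assert (0 <= (1 - q s ^ 2) * z ^ 2)
          by (apply Rmult_le_pos; nra).
        pose proof (pow2_ge_0 (y - q s * z)). nra. }
      assert (0 <= z ^ 2) by nra.
      nra. }
  assert (D 0 = 0) as HD0 by (unfold D; rewrite Hp0, Hq0, Hr0; ring).
  rewrite HD0, Rmult_0_r in HD.
  pose proof (exp_pos (- 4 * t)).
  assert (D t <= 0) as HDt by nra.
  unfold D in HDt.
  pose proof (pow2_ge_0 (p' t - p t)).
  pose proof (pow2_ge_0 (q' t - q t)).
  pose proof (pow2_ge_0 (r' t - r t)).
  repeat split; nra.
Qed.

(** * Gauss' transformation of the elliptic speed *)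

(** Reciprocal of the integrand in Gauss' form of the complete elliptic integral, whose value is
    governed by the AGM of [a] and [b]. *)
Definition ell_speed (a b t : R) : R :=
  sqrt (a ^ 2 * cos t ^ 2 + b ^ 2 * sin t ^ 2).

Lemma cos_sin_sqr (t : R) : cos t ^ 2 + sin t ^ 2 = 1.
Proof. pose proof (sin2_cos2 t) as H. unfold Rsqr in H. lra. Qed.

Lemma ell_speed_pos (a b t : R) : 0 < a -> 0 < b -> 0 < ell_speed a b t.
Proof.
  intros Ha Hb. apply sqrt_lt_R0.
  pose proof (cos_sin_sqr t) as E.
  assert (0 < a ^ 2) by nra. assert (0 < b ^ 2) by nra.
  pose proof (pow2_ge_0 (cos t)). pose proof (pow2_ge_0 (sin t)).
  destruct (Req_dec (sin t ^ 2) 0) as [Z | Z].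
  - rewrite Z in *. nra.
  - assert (0 < sin t ^ 2) by lra. nra.
Qed.

Lemma ell_speed_sqr (a b t : R) :
  ell_speed a b t ^ 2 = a ^ 2 * cos t ^ 2 + b ^ 2 * sin t ^ 2.
Proof.
  unfold ell_speed. rewrite pow2_sqrt; trivial.
  pose proof (pow2_ge_0 (a * cos t)). pose proof (pow2_ge_0 (b * sin t)). nra.
Qed.

Lemma ell_speed_le (a b t : R) : 0 < b <= a -> ell_speed a b t <= a.
Proof.
  intros H. apply Rsqr_incr_0_var; [ | lra].
  rewrite !Rsqr_pow2, ell_speed_sqr.
  pose proof (cos_sin_sqr t). pose proof (pow2_ge_0 (sin t)).
  assert (b ^ 2 <= a ^ 2) by nra. nra.
Qed.

(** The angle [s] with [tan (s - t) = (b / a) * tan t]. For positive [a] and [b] the denominator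
    never vanishes, so this form is smooth on the whole line, with no jump between branches. *)
Definition landen (a b t : R) : R :=
  2 * t + atan ((b - a) * (sin t * cos t) / (a * cos t ^ 2 + b * sin t ^ 2)).

Lemma landen_period (a b t : R) (k : nat) :
  landen a b (t + 2 * INR k * PI) = landen a b t + 2 * INR (2 * k) * PI.
Proof.
  unfold landen. rewrite sin_period, cos_period, mult_INR. simpl (INR 2). ring.
Qed.

(* One step of Gauss' transformation: if [t' = ell_speed a b t], then
   [s = landen a b t] satisfies [s' = 2 ell_speed ((a+b)/2) (sqrt (a b)) s]. *)
Lemma landen_derive (a b t : R) : 0 < a -> 0 < b ->
  is_derive (landen a b) t
    (2 * ell_speed ((a + b) / 2) (sqrt (a * b)) (landen a b t)
       / ell_speed a b t).
Proof.
  intros Ha Hb.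
  pose proof (cos_sin_sqr t) as E.
  pose proof (ell_speed_pos a b t Ha Hb) as HD.
  pose proof (ell_speed_sqr a b t) as HD2.
  set (D := ell_speed a b t) in *.
  set (h := a * cos t ^ 2 + b * sin t ^ 2).
  set (g := (b - a) * (sin t * cos t)).
  assert (Hh : 0 < h).
  { unfold h. pose proof (pow2_ge_0 (cos t)). pose proof (pow2_ge_0 (sin t)).
    destruct (Req_dec (sin t ^ 2) 0) as [Z | Z].
    - rewrite Z in *. nra.
    - assert (0 < sin t ^ 2) by lra. nra. }
  (* The angle [atan (g / h)] is that of the vector [(h, g)], of length [D]; its cosine and sine are
     thus [h / D] and [g / D]. *)
  assert (HgD : h ^ 2 + g ^ 2 = D ^ 2).
  { rewrite HD2. unfold h, g.
    transitivity ((a ^ 2 * cos t ^ 2 + b ^ 2 * sin t ^ 2)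
                  * (cos t ^ 2 + sin t ^ 2)); [ring | rewrite E; ring]. }
  assert (Hs : sqrt (1 + (g / h) ^ 2) = D / h).
  { replace (1 + (g / h) ^ 2) with ((D / h) ^ 2).
    - apply sqrt_pow2. apply Rlt_le, Rdiv_lt_0_compat; trivial.
    - unfold Rdiv. rewrite !Rpow_mult_distr, <- HgD. field. lra. }
  assert (Hcos : cos (landen a b t) = (a * cos t ^ 2 - b * sin t ^ 2) / D).
  { unfold landen. fold h g. rewrite cos_plus, cos_atan, sin_atan.
    rewrite cos_2a, sin_2a. rewrite !Rsqr_pow2, Hs.
    transitivity (((cos t * cos t - sin t * sin t) * h
                   - 2 * sin t * cos t * g) / D); [field; lra | ].
    unfold g, h.
    transitivity ((a * cos t ^ 2 - b * sin t ^ 2) * (cos t ^ 2 + sin t ^ 2) / D);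
      [field; lra | rewrite E; field; lra]. }
  assert (Hsin : sin (landen a b t) = (a + b) * (sin t * cos t) / D).
  { unfold landen. fold h g. rewrite sin_plus, cos_atan, sin_atan.
    rewrite cos_2a, sin_2a. rewrite !Rsqr_pow2, Hs.
    transitivity ((2 * sin t * cos t * h
                   + (cos t * cos t - sin t * sin t) * g) / D); [field; lra | ].
    unfold g, h.
    transitivity ((a + b) * (sin t * cos t) * (cos t ^ 2 + sin t ^ 2) / D);
      [field; lra | rewrite E; field; lra]. }
  assert (Hab : sqrt (a * b) ^ 2 = a * b) by (apply pow2_sqrt; nra).
  assert (Hsp : 2 * ell_speed ((a + b) / 2) (sqrt (a * b)) (landen a b t)
                = (a + b) * h / D).
  { assert (X : ell_speed ((a + b) / 2) (sqrt (a * b)) (landen a b t)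
                = (a + b) * h / (2 * D)).
    { unfold ell_speed. rewrite Hab, Hcos, Hsin.
      replace (_ + _) with (((a + b) * h / (2 * D)) ^ 2).
      - apply sqrt_pow2. apply Rlt_le, Rdiv_lt_0_compat; nra.
      - unfold h. field. lra. }
    rewrite X. field. lra. }
  rewrite Hsp.
  unfold landen. auto_derive.
  - change (h <> 0). lra.
  - change (a * (cos t * (cos t * 1)) + b * (sin t * (sin t * 1))) with h.
    change ((b - a) * (sin t * cos t)) with g.
    set (u := (b - a) * (1 * cos t * cos t + sin t * (1 * - sin t))).
    set (w := a * (1 * - sin t * ((1 + 1) * (cos t * 1))) +
              b * (1 * cos t * ((1 + 1) * (sin t * 1)))).
    assert (HD' : 0 < D ^ 2) by nra.
    (* Here [u] and [w] are the derivatives of [g] and [h]. *)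
    transitivity (2 + (u * h - g * w) / (h ^ 2 + g ^ 2)).
    { field. split; [ | lra]. nra. }
    rewrite HgD.
    assert (Hw : u * h - g * w = a * b - D ^ 2).
    { rewrite HD2. unfold u, w, g, h.
      transitivity (a * b * (cos t ^ 2 + sin t ^ 2) ^ 2
         - (a ^ 2 * cos t ^ 2 + b ^ 2 * sin t ^ 2) * (cos t ^ 2 + sin t ^ 2));
        [ring | rewrite E; ring]. }
    rewrite Hw.
    replace ((a + b) * h) with (2 * D ^ 2 + (a * b - D ^ 2)).
    + field. lra.
    + rewrite HD2. unfold h.
      transitivity (a ^ 2 * cos t ^ 2 + b ^ 2 * sin t ^ 2
                    + a * b * (cos t ^ 2 + sin t ^ 2)); [rewrite E | ]; ring.
Qed.

(** * Bounds on the arithmetic-geometric mean *)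

Lemma agm_seq_pos (a b : R) (n : nat) : 0 < a -> 0 < b ->
  0 < fst (agm_seq a b n) /\ 0 < snd (agm_seq a b n).
Proof.
  intros Ha Hb. induction n as [ | n IH]; simpl; auto.
  destruct (agm_seq a b n) as [x y]; simpl in *. destruct IH.
  split; [lra | apply sqrt_lt_R0; nra].
Qed.

Lemma agm_seq_ge (a b m : R) (n : nat) : 0 < m -> m <= a -> m <= b ->
  m <= fst (agm_seq a b n) /\ m <= snd (agm_seq a b n).
Proof.
  intros Hm Ha Hb. induction n as [ | n IH]; simpl; auto.
  destruct (agm_seq a b n) as [x y]; simpl in *. destruct IH.
  split; [lra | ].
  rewrite <- (sqrt_pow2 m) by lra. apply sqrt_le_1_alt. nra.
Qed.

Lemma sqrt_mult_le_mean (x y : R) : 0 < x -> 0 < y -> sqrt (x * y) <= (x + y) / 2.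
Proof.
  intros Hx Hy. rewrite <- (sqrt_pow2 ((x + y) / 2)) by lra.
  apply sqrt_le_1_alt. pose proof (pow2_ge_0 (x - y)). nra.
Qed.

(** The initial pair may come in either order, and on loop level sets it has [a < b]; the inequality
    of means orders the pair from index 1 on. *)
Lemma agm_seq_snd_le_fst (a b : R) (n : nat) : 0 < a -> 0 < b ->
  snd (agm_seq a b (S n)) <= fst (agm_seq a b (S n)).
Proof.
  intros Ha Hb. destruct (agm_seq_pos a b n Ha Hb) as [Hx Hy]. simpl.
  destruct (agm_seq a b n) as [x y]; simpl in *.
  now apply sqrt_mult_le_mean.
Qed.

(** [real] sends an infinite limit to 0, so finiteness has to be shown first: from index 1 on the
    sequence decreases, and [m] bounds it below. *)
Lemma AGM_ge (a b m : R) : 0 < a -> 0 < b ->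
  (forall n, m <= fst (agm_seq a b (S n))) -> m <= AGM a b.
Proof.
  intros Ha Hb Hm. unfold AGM.
  rewrite <- Lim_seq_incr_1.
  set (u := fun n => fst (agm_seq a b (S n))).
  assert (Hu : ex_finite_lim_seq u).
  { apply (ex_finite_lim_seq_decr u m); [ | exact Hm].
    intros n. pose proof (agm_seq_snd_le_fst a b n Ha Hb) as H. unfold u.
    change (agm_seq a b (S (S n))) with
      (let '(x, y) := agm_seq a b (S n) in ((x + y) / 2, sqrt (x * y))).
    destruct (agm_seq a b (S n)) as [x y]; simpl in *. lra. }
  destruct Hu as [l Hl].
  rewrite (is_lim_seq_unique _ _ Hl). simpl.
  exact (is_lim_seq_le _ _ m l Hm (is_lim_seq_const m) Hl).
Qed.

(** * Phase of a flow line and time of a full turn *)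

(** Composition of [n] Gauss steps. Each step doubles both the speed factor and the number of turns,
    while the two parameters approach each other. *)
Lemma landen_iter (a b : R) (n : nat) : 0 < a -> 0 < b ->
  exists F : R -> R,
    (forall t, is_derive F t
       (2 ^ n * ell_speed (fst (agm_seq a b n)) (snd (agm_seq a b n)) (F t)
          / ell_speed a b t)) /\
    (forall t k, F (t + 2 * INR k * PI) = F t + 2 * INR (2 ^ n * k) * PI).
Proof.
  intros Ha Hb. induction n as [ | n [F [HF HP]]].
  - exists (fun t => t). split.
    + intros t. simpl.
      replace (1 * _ / _) with 1
        by (field; apply Rgt_not_eq, ell_speed_pos; trivial).
      auto_derive; trivial.
    + intros t k. simpl. now rewrite Nat.add_0_r.
  - destruct (agm_seq_pos a b n Ha Hb) as [Hx Hy].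
    simpl agm_seq. destruct (agm_seq a b n) as [x y]; simpl fst in *; simpl snd in *.
    exists (fun t => landen x y (F t)). split.
    + intros t. evar_last.
      * apply (is_derive_comp (landen x y) F); [ | apply HF].
        apply landen_derive; trivial.
      * unfold scal; simpl; unfold mult; simpl. field. split;
        apply Rgt_not_eq, ell_speed_pos; trivial.
    + intros t k. rewrite HP, landen_period. do 4 f_equal. simpl. lia.
Qed.

(* On the unit sphere with [p q = c] one has
   [(p - q)^2 + r^2 = 1 - 2 c], so a flow line rotates on a circle. *)
Lemma sigma_phase (p q r : R -> R) (k : R) :
  sigma_curve p q r -> 0 < k -> 0 < r 0 ->
  (p 0 - q 0) ^ 2 + r 0 ^ 2 = k ^ 2 ->
  exists X : R -> R,
    - PI / 2 < X 0 < PI / 2 /\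
    (forall t, is_derive X t (p t + q t)) /\
    (forall t, p t - q t = k * sin (X t)) /\
    (forall t, r t = k * cos (X t)).
Proof.
  intros H Hk Hr0 Hc.
  (* Since [r 0 > 0], the point [(r, p - q)] starts in the right half-plane, where [atan] recovers
     its angle. *)
  set (x0 := atan ((p 0 - q 0) / r 0)).
  set (X := fun t => x0 + RInt (fun s => p s + q s) 0 t).
  assert (Hcont : forall t, continuous (fun s => p s + q s) t).
  { intros t. apply (ex_derive_continuous (fun s => p s + q s)).
    destruct (H t) as [Hp [Hq _]].
    eexists. apply @is_derive_plus; eassumption. }
  assert (HX : forall t, is_derive X t (p t + q t)).
  { intros t. unfold X. evar_last.
    - apply @is_derive_plus; [apply is_derive_const | ].
      apply (is_derive_RInt (fun s => p s + q s) _ 0 t).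
      + apply filter_forall. intros s. apply (RInt_correct (V := R_CompleteNormedModule)).
        apply (ex_RInt_continuous (V := R_CompleteNormedModule) (fun s => p s + q s)). intros; apply Hcont.
      + apply Hcont.
    - unfold plus, zero; simpl. ring. }
  assert (HX0 : X 0 = x0).
  { unfold X. rewrite RInt_point. unfold zero; simpl. ring. }
  assert (Hs : sqrt (1 + ((p 0 - q 0) / r 0) ^ 2) = k / r 0).
  { replace (1 + _) with ((k / r 0) ^ 2).
    - apply sqrt_pow2, Rlt_le, Rdiv_lt_0_compat; lra.
    - unfold Rdiv at 1. rewrite Rpow_mult_distr, <- Hc. field. lra. }
  (* Both [(p - q, r)] and [k (sin X, cos X)] rotate with angular speed [p + q], so their distance
     keeps its initial value 0. *)
  assert (Hdist : forall t,
    (p t - q t - k * sin (X t)) ^ 2 + (r t - k * cos (X t)) ^ 2 = 0).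
  { intros t.
    rewrite (is_derive_zero_const (fun t =>
      (p t - q t - k * sin (X t)) ^ 2 + (r t - k * cos (X t)) ^ 2)).
    - rewrite HX0. unfold x0. rewrite cos_atan, sin_atan, !Rsqr_pow2, Hs.
      field. lra.
    - intros s. destruct (H s) as [Hp [Hq Hr]]. pose proof (HX s) as Hx.
      derive_from_hyps. ring. }
  exists X. split; [ | split; [exact HX | split]].
  - rewrite HX0. pose proof (atan_bound ((p 0 - q 0) / r 0)). unfold x0. lra.
  - intros t. specialize (Hdist t).
    pose proof (pow2_ge_0 (p t - q t - k * sin (X t))).
    pose proof (pow2_ge_0 (r t - k * cos (X t))). nra.
  - intros t. specialize (Hdist t).
    pose proof (pow2_ge_0 (p t - q t - k * sin (X t))).
    pose proof (pow2_ge_0 (r t - k * cos (X t))). nra.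
Qed.

(** After [S n] Gauss steps a full turn of [X] becomes [2 ^ S n] turns of [F (X t)], whose speed is
    at most [2 * 2 ^ S n * x] with [x] the larger AGM entry. Hence [PI <= x * T] for every [n], and
    this passes to the limit. *)
Lemma ell_speed_full_turn (a b T : R) (X : R -> R) :
  0 < a -> 0 < b -> 0 < T ->
  (forall t, is_derive X t (2 * ell_speed a b (X t))) ->
  X 0 + 2 * PI <= X T ->
  PI / AGM a b <= T.
Proof.
  intros Ha Hb HT HX Hturn.
  pose proof PI_RGT_0 as Hpi.
  assert (Hm : PI / T <= AGM a b).
  { apply AGM_ge; trivial. intros n.
    destruct (landen_iter a b (S n) Ha Hb) as [F [HF HP]].
    pose proof (agm_seq_snd_le_fst a b n Ha Hb) as Hle.
    destruct (agm_seq_pos a b (S n) Ha Hb) as [Hx Hy].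
    set (x := fst (agm_seq a b (S n))) in *.
    set (y := snd (agm_seq a b (S n))) in *.
    assert (H2 : 0 < 2 ^ S n) by (apply pow_lt; lra).
    assert (Hmono : F (X 0 + 2 * PI) <= F (X T)).
    { destruct (Rle_lt_or_eq_dec _ _ Hturn) as [Hlt | Heq].
      - apply Rlt_le. refine (is_derive_pos_lt F _ _ _ Hlt HF _).
        intros t. apply Rdiv_lt_0_compat; [apply Rmult_lt_0_compat | ];
          trivial; apply ell_speed_pos; trivial.
      - rewrite Heq. lra. }
    pose proof (HP (X 0) 1%nat) as HP1.
    rewrite Nat.mul_1_r, pow_INR in HP1. simpl INR in HP1.
    replace (X 0 + 2 * 1 * PI) with (X 0 + 2 * PI) in HP1 by ring.
    replace (1 + 1) with 2 in HP1 by ring.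
    assert (Hub : F (X T) - 2 * 2 ^ S n * x * T <= F (X 0) - 2 * 2 ^ S n * x * 0).
    { apply (is_derive_nonpos_le (fun t => F (X t) - 2 * 2 ^ S n * x * t)
        (fun t => 2 * 2 ^ S n * (ell_speed x y (F (X t)) - x))); [lra | | ].
      - intros t _. pose proof (HX t) as HXt. pose proof (HF (X t)) as HFt.
        evar_last.
        + apply @is_derive_minus;
            [apply (is_derive_comp F X); eassumption | ].
          apply is_derive_scal, is_derive_id.
        + unfold scal, minus, plus, opp, one; simpl; unfold mult; simpl.
          field. apply Rgt_not_eq, ell_speed_pos; trivial.
      - intros t _. pose proof (ell_speed_le x y (F (X t))). nra. }
    apply Rmult_le_reg_r with (T * (2 * 2 ^ S n)); [nra | ].
    replace (PI / T * (T * (2 * 2 ^ S n))) with (2 * 2 ^ S n * PI)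
      by (field; lra).
    lra. }
  assert (0 < PI / T) by (apply Rdiv_lt_0_compat; lra).
  apply Rmult_le_reg_r with (AGM a b / T).
  - apply Rdiv_lt_0_compat; lra.
  - replace (PI / AGM a b * (AGM a b / T)) with (PI / T) by (field; lra).
    replace (T * (AGM a b / T)) with (AGM a b) by (field; lra). trivial.
Qed.

(** Meant for [s = p + q], where [(p + q)^2 = 4 p q + (p - q)^2] and [p - q = k sin x] with
    [k^2 = 1 - 2 c]. *)
Lemma ell_speed_loop (c x s : R) :
  0 < c -> 0 < s -> s ^ 2 = 4 * c + (1 - 2 * c) * sin x ^ 2 ->
  s = 2 * ell_speed (sqrt c) (/ 2 * sqrt (1 + 2 * sqrt c ^ 2)) x.
Proof.
  intros Hc Hs Heq.
  assert (0 <= ell_speed (sqrt c) (/ 2 * sqrt (1 + 2 * sqrt c ^ 2)) x)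
    by apply sqrt_pos.
  apply Rsqr_inj; [lra | lra | ].
  rewrite !Rsqr_pow2, Rpow_mult_distr, ell_speed_sqr, Rpow_mult_distr, Heq.
  rewrite !pow2_sqrt by (rewrite ?pow2_sqrt; lra).
  pose proof (cos_sin_sqr x). nra.
Qed.

(** The second AGM entry is at least [/ 2], so both entries are at least [d]. Contrapositively, a
    period above [PI / d] forces [sqrt c < d]. *)
Lemma loop_period_le (c d : R) :
  0 < d <= / 2 -> d <= sqrt c -> loop_period c <= PI / d.
Proof.
  intros Hd Hc. unfold loop_period.
  assert (Hb : / 2 <= / 2 * sqrt (1 + 2 * sqrt c ^ 2)).
  { rewrite <- (Rmult_1_r (/ 2)) at 1. apply Rmult_le_compat_l; [lra | ].
    rewrite <- sqrt_1 at 1. apply sqrt_le_1_alt. nra. }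
  apply Rmult_le_compat_l; [apply Rlt_le, PI_RGT_0 | ].
  apply Rinv_le_contravar; [lra | ].
  apply AGM_ge; [lra | lra | ].
  intros n. apply agm_seq_ge; lra.
Qed.

(** * Integral of q^2 along a symmetric arc *)

(* From [(r q^2)' = - q^2 (1 + r^2 - 2 q^2)] and [q^2 <= p q = c]. *)
Lemma sigma_increment_le_far (p q r Z : R -> R) (c s t : R) :
  sigma_curve p q r ->
  (forall x, p x ^ 2 + q x ^ 2 + r x ^ 2 = 1) ->
  (forall x, p x * q x = c) ->
  (forall x, is_derive Z x (q x ^ 2)) ->
  s <= t ->
  (forall x, s <= x <= t -> 0 < q x <= p x) ->
  (1 - 2 * c) * (Z t - Z s) <= r s * q s ^ 2 - r t * q t ^ 2.
Proof.
  intros H Hn Hc HZ Hst Hqp.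
  assert ((1 - 2 * c) * Z t + r t * q t ^ 2
          <= (1 - 2 * c) * Z s + r s * q s ^ 2); [ | lra].
  apply (is_derive_nonpos_le (fun x => (1 - 2 * c) * Z x + r x * q x ^ 2)
    (fun x => - q x ^ 2 * (2 * c + r x ^ 2 - 2 * q x ^ 2))); trivial.
  - intros x _. destruct (H x) as [Hp [Hq Hr]]. pose proof (HZ x) as Hz.
    specialize (Hn x).
    derive_from_hyps.
    replace (p x ^ 2) with (1 - q x ^ 2 - r x ^ 2) by lra. ring.
  - intros x Hx. specialize (Hqp x Hx). specialize (Hc x).
    assert (q x ^ 2 <= c) by nra.
    assert (0 <= q x ^ 2 * (2 * c + r x ^ 2 - 2 * q x ^ 2))
      by (apply Rmult_le_pos; nra).
    lra.
Qed.

(* From [r' = q^2 - p^2], [(r p^2)' = p^2 (1 + r^2 - 2 p^2)] and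
   [p^2 <= p q = c]. *)
Lemma sigma_increment_le_near (p q r Z : R -> R) (c s t : R) :
  sigma_curve p q r ->
  (forall x, p x ^ 2 + q x ^ 2 + r x ^ 2 = 1) ->
  (forall x, p x * q x = c) ->
  (forall x, is_derive Z x (q x ^ 2)) ->
  s <= t ->
  (forall x, s <= x <= t -> 0 < p x <= q x) ->
  (1 - 2 * c) * (Z t - Z s - (r t - r s)) <= r t * p t ^ 2 - r s * p s ^ 2.
Proof.
  intros H Hn Hc HZ Hst Hqp.
  assert ((1 - 2 * c) * (Z t - r t) - r t * p t ^ 2
          <= (1 - 2 * c) * (Z s - r s) - r s * p s ^ 2); [ | lra].
  apply (is_derive_nonpos_le
    (fun x => (1 - 2 * c) * (Z x - r x) - r x * p x ^ 2)
    (fun x => - p x ^ 2 * (2 * c + r x ^ 2 - 2 * p x ^ 2))); trivial.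
  - intros x _. destruct (H x) as [Hp [Hq Hr]]. pose proof (HZ x) as Hz.
    specialize (Hn x).
    derive_from_hyps.
    replace (q x ^ 2) with (1 - p x ^ 2 - r x ^ 2) by lra. ring.
  - intros x Hx. specialize (Hqp x Hx). specialize (Hc x).
    assert (p x ^ 2 <= c) by nra.
    assert (0 <= p x ^ 2 * (2 * c + r x ^ 2 - 2 * p x ^ 2))
      by (apply Rmult_le_pos; nra).
    lra.
Qed.

(** The sum [x + y] is an odd multiple of [PI] strictly between [- PI] and [3 * PI]. *)
Lemma reflected_angle (x y : R) :
  - PI / 2 < x < PI / 2 -> x < y < x + 2 * PI ->
  sin y = sin x -> cos y = - cos x -> y = PI - x.
Proof.
  intros Hx Hy Hs Hc.
  assert (Hsin : sin (x + y) = 0) by (rewrite sin_plus, Hs, Hc; ring).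
  assert (Hcos : cos (x + y) = - 1).
  { rewrite cos_plus, Hs, Hc. pose proof (cos_sin_sqr x). lra. }
  pose proof PI_RGT_0.
  destruct (Rtotal_order (x + y) PI) as [Hlt | [Heq | Hgt]]; [ | lra | ].
  - exfalso. assert (Hge : 0 <= x + y \/ x + y < 0) by lra.
    destruct Hge as [Hge | Hneg].
    + destruct (Req_dec (x + y) 0) as [H0 | H0].
      * rewrite H0, cos_0 in Hcos. lra.
      * pose proof (sin_gt_0 (x + y)). lra.
    + pose proof (sin_lt_0_var (x + y)). lra.
  - exfalso. destruct (Rtotal_order (x + y) (2 * PI)) as [Hlt | [Heq | Hgt2]].
    + pose proof (sin_lt_0 (x + y)). lra.
    + rewrite Heq, cos_2PI in Hcos. lra.
    + pose proof (sin_gt_0 (x + y - 2 * PI)) as Hpos.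
      replace (sin (x + y - 2 * PI)) with (sin (x + y)) in Hpos
        by (rewrite <- (sin_period (x + y - 2 * PI) 1); f_equal; simpl; ring).
      lra.
Qed.

Lemma increasing_reaches (X dX : R -> R) (T v : R) :
  (forall t, is_derive X t (dX t)) -> 0 <= T -> X 0 <= v <= X T ->
  exists t, 0 <= t <= T /\ X t = v.
Proof.
  intros HX HT Hv.
  destruct (IVT_gen X 0 T v) as [t [Ht Heq]].
  - intros x. apply is_derive_continuity_pt with (dX x), HX.
  - rewrite Rmin_left, Rmax_right; lra.
  - exists t. rewrite Rmin_left, Rmax_right in Ht by lra. auto.
Qed.

Lemma symmetric_flow_bound (p q r Z : R -> R) (c T : R) :
  sigma_curve p q r ->
  (forall t, 0 < p t) -> (forall t, 0 < q t) -> 0 < r 0 ->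
  (forall t, p t ^ 2 + q t ^ 2 + r t ^ 2 = 1) ->
  (forall t, p t * q t = c) -> c <= / 4 ->
  0 < T < loop_period c ->
  p T = p 0 -> q T = q 0 -> r T = - r 0 ->
  (forall t, is_derive Z t (q t ^ 2)) ->
  Z T - Z 0 <= (2 + 10 * sqrt c) * q 0.
Proof.
  intros H Hp Hq Hr0 Hn Hc Hc4 HT HpT HqT HrT HZ.
  assert (Hc0 : 0 < c) by (rewrite <- (Hc 0); apply Rmult_lt_0_compat; auto).
  pose proof PI_RGT_0 as Hpi.
  set (k := sqrt (1 - 2 * c)).
  assert (Hk : 0 < k) by (apply sqrt_lt_R0; lra).
  assert (Hk2 : k ^ 2 = 1 - 2 * c) by (apply pow2_sqrt; lra).
  assert (Hk1 : k <= 1) by nra.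
  destruct (sigma_phase p q r k H Hk Hr0) as [X [HX0 [HX [HXs HXc]]]].
  { rewrite Hk2, <- (Hn 0), <- (Hc 0). ring. }
  assert (Hincr : forall s t, s < t -> X s < X t).
  { intros s t Hst. apply (is_derive_pos_lt X _ s t Hst HX).
    intros x. specialize (Hp x). specialize (Hq x). lra. }
  assert (HXT : X T = PI - X 0).
  { apply reflected_angle; trivial.
    - split; [apply Hincr; lra | ].
      (* Otherwise [X] gains a full turn by time [T], and the period is at most [T]. *)
      apply Rnot_le_lt. intros Hle.
      assert (loop_period c <= T); [ | lra].
      apply (ell_speed_full_turn _ _ _ X); trivial; try lra.
      + now apply sqrt_lt_R0.
      + apply Rmult_lt_0_compat; [lra | apply sqrt_lt_R0]. nra.
      + intros t. rewrite <- (ell_speed_loop c (X t) (p t + q t)); auto.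
        * specialize (Hp t). specialize (Hq t). lra.
        * rewrite <- Hk2, <- Rpow_mult_distr, <- HXs, <- (Hc t). ring.
    - apply Rmult_eq_reg_l with k; [ | lra]. rewrite <- !HXs. lra.
    - apply Rmult_eq_reg_l with k; [ | lra].
      rewrite Ropp_mult_distr_r_reverse, <- !HXc. lra. }
  assert (Hfar : forall t, 0 <= X t <= PI -> 0 < q t <= p t).
  { intros t Ht. split; [apply Hq | ].
    pose proof (sin_ge_0 (X t)). specialize (HXs t). nra. }
  assert (Hmon : forall s t, s <= t -> X s <= X t).
  { intros s t [Hlt | ->]; [apply Rlt_le; auto | lra]. }
  assert (Hsq : 0 < sqrt c) by now apply sqrt_lt_R0.
  assert (Hsq2 : sqrt c ^ 2 = c) by (apply pow2_sqrt; lra).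
  pose proof (Hp 0) as Hp0. pose proof (Hq 0) as Hq0.
  pose proof (Hn 0) as Hn0. pose proof (Hc 0) as Hpq0.
  destruct (Rle_lt_dec 0 (X 0)) as [Hpos | Hneg].
  (* The arc stays where [q <= p]; here [q 0 <= sqrt c], and [1 - 2 c >= 1/2] costs a factor 2. *)
  - assert (Hle : (1 - 2 * c) * (Z T - Z 0) <= r 0 * q 0 ^ 2 - r T * q T ^ 2).
    { apply (sigma_increment_le_far p); trivial; [lra | ].
      intros x Hx. apply Hfar.
      pose proof (Hmon 0 x). pose proof (Hmon x T). lra. }
    rewrite HrT, HqT in Hle.
    destruct (Hfar 0) as [_ Hqp]; [lra | ].
    assert (Hqs : q 0 <= sqrt c).
    { apply Rsqr_incr_0_var; [ | lra]. rewrite !Rsqr_pow2. nra. }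
    assert (Hr1 : r 0 <= 1) by nra.
    assert (r 0 * q 0 ^ 2 <= sqrt c * q 0) by nra.
    assert (Hd : 0 <= sqrt c * q 0) by nra.
    nra.
  (* Cut the arc where [X] is 0 and [PI], that is, where [p = q]: the outer pieces have [p <= q],
     the middle one [q <= p]. *)
  - destruct (increasing_reaches X _ T 0 HX) as [t1 [Ht1 HX1]]; [lra | lra | ].
    destruct (increasing_reaches X _ T PI HX) as [t2 [Ht2 HX2]]; [lra | lra | ].
    assert (H12 : t1 <= t2).
    { apply Rnot_lt_le. intros Hlt. apply Hincr in Hlt. lra. }
    assert (Hnear : forall t, 0 <= t <= t1 \/ t2 <= t <= T -> 0 < p t <= q t).
    { intros t Ht. split; [apply Hp | ].
      assert (sin (X t) <= 0).
      { destruct Ht as [Ht | Ht].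
        - pose proof (Hmon 0 t). pose proof (Hmon t t1).
          pose proof (sin_ge_0 (- X t)) as Hs. rewrite sin_neg in Hs. lra.
        - pose proof (Hmon t2 t). pose proof (Hmon t T).
          apply sin_le_0; lra. }
      specialize (HXs t). nra. }
    assert (L1 : (1 - 2 * c) * (Z t1 - Z 0 - (r t1 - r 0))
                 <= r t1 * p t1 ^ 2 - r 0 * p 0 ^ 2).
    { apply (sigma_increment_le_near p q); trivial; [lra | ].
      intros x Hx. apply Hnear. lra. }
    assert (L2 : (1 - 2 * c) * (Z t2 - Z t1)
                 <= r t1 * q t1 ^ 2 - r t2 * q t2 ^ 2).
    { apply (sigma_increment_le_far p); trivial.
      intros x Hx. apply Hfar.
      pose proof (Hmon t1 x). pose proof (Hmon x t2). lra. }
    assert (L3 : (1 - 2 * c) * (Z T - Z t2 - (r T - r t2))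
                 <= r T * p T ^ 2 - r t2 * p t2 ^ 2).
    { apply (sigma_increment_le_near p q); trivial; [lra | ].
      intros x Hx. apply Hnear. lra. }
    assert (E1 : p t1 = q t1 /\ r t1 = k).
    { pose proof (HXs t1) as Es. pose proof (HXc t1) as Ec.
      rewrite HX1, sin_0 in Es. rewrite HX1, cos_0 in Ec. lra. }
    assert (E2 : p t2 = q t2 /\ r t2 = - k).
    { pose proof (HXs t2) as Es. pose proof (HXc t2) as Ec.
      rewrite HX2, sin_PI in Es. rewrite HX2, cos_PI in Ec. lra. }
    destruct E1 as [E1 R1]. destruct E2 as [E2 R2].
    assert (Q1 : q t1 ^ 2 = c) by (rewrite <- (Hc t1), E1; ring).
    assert (Q2 : q t2 ^ 2 = c) by (rewrite <- (Hc t2), E2; ring).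
    rewrite R1, E1, Q1 in L1. rewrite R1, R2, Q1, Q2 in L2.
    rewrite R2, E2, Q2, HrT, HpT in L3.
    assert (Hsum : (1 - 2 * c) * (Z T - Z 0 - 2 * (k - r 0)) <= 4 * k * c).
    { assert (0 <= r 0 * p 0 ^ 2) by (apply Rmult_le_pos; nra). lra. }
    assert (Hpq : 0 < p 0 <= q 0) by (apply Hnear; lra).
    assert (Hq1 : q 0 <= 1) by nra.
    assert (Hr1 : r 0 <= 1) by nra.
    assert (Hp2 : p 0 ^ 2 <= c) by nra.
    (* [1 - r 0 <= 1 - r 0 ^ 2 = p 0 ^ 2 + q 0 ^ 2]. *)
    assert (H1r : 1 - r 0 <= q 0 + c) by nra.
    assert (Hqs : sqrt c <= q 0).
    { apply Rsqr_incr_0_var; [ | lra]. rewrite !Rsqr_pow2. nra. }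
    assert (Hcq : c <= sqrt c * q 0) by nra.
    assert (k * c <= c) by nra.
    (* Dividing [4 k c] by [1 - 2 c >= 1/2] gives [8 c]. With the [2 c] coming from [2 (1 - r 0)]
       this makes [10 c], at most [10 sqrt c * q 0]. *)
    assert (Z T - Z 0 - 2 * (k - r 0) <= 8 * c).
    { apply Rnot_lt_le. intros Hlt. nra. }
    lra.
Qed.

(** * Geodesics of Sol and the bound on b *)

Lemma norm3_scale (l x y z : R) :
  0 <= l -> norm3 (l * x) (l * y) (l * z) = l * norm3 x y z.
Proof.
  intros Hl. unfold norm3.
  replace ((l * x) ^ 2 + (l * y) ^ 2 + (l * z) ^ 2)
    with (l ^ 2 * (x ^ 2 + y ^ 2 + z ^ 2)) by ring.
  rewrite sqrt_mult_alt by apply pow2_ge_0. now rewrite sqrt_pow2.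
Qed.

(* In the left-invariant frame and rescaled to unit speed, a geodesic becomes
   a [sigma_curve], with [y' = q^2 / q 0]. *)
Lemma sol_exp_flow (V1 V2 V3 a b c' : R) :
  positive3 V1 V2 V3 -> sol_exp V1 V2 V3 a b c' ->
  let n := norm3 V1 V2 V3 in
  exists p q r Y : R -> R,
    sigma_curve p q r /\
    (forall t, 0 < p t) /\ (forall t, 0 < q t) /\
    p 0 = V1 / n /\ q 0 = V2 / n /\ r 0 = V3 / n /\
    (forall t, is_derive Y t (q t ^ 2 / q 0)) /\ Y 0 = 0 /\ Y n = b.
Proof.
  intros [HV1 [HV2 HV3]] (x & y & z & u & v & w & H & Hx0 & Hy0 & Hz0 & Hu0 &
    Hv0 & Hw0 & _ & Hy1 & _) n.
  assert (Hn : 0 < n) by (apply sqrt_lt_R0; nra).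
  (* Translations in x and y are isometries; the corresponding first integrals are [u * exp (- 2 z)]
     and [v * exp (2 z)]. *)
  assert (Hu : forall t, u t = V1 * exp (2 * z t)).
  { intros t. apply Rmult_eq_reg_r with (exp (- 2 * z t));
      [ | apply Rgt_not_eq, exp_pos].
    rewrite (is_derive_zero_const (fun t => u t * exp (- 2 * z t))).
    - rewrite Hu0, Hz0, Rmult_assoc, <- exp_plus. f_equal. f_equal. ring.
    - intros s. destruct (H s) as (_ & _ & Hz & Hu & _ & _).
      derive_from_hyps. ring. }
  assert (Hv : forall t, v t = V2 * exp (- 2 * z t)).
  { intros t. apply Rmult_eq_reg_r with (exp (2 * z t));
      [ | apply Rgt_not_eq, exp_pos].
    rewrite (is_derive_zero_const (fun t => v t * exp (2 * z t))).
    - rewrite Hv0, Hz0, Rmult_assoc, <- exp_plus. f_equal. f_equal. ring.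
    - intros s. destruct (H s) as (_ & _ & Hz & _ & Hv & _).
      derive_from_hyps. ring. }
  (* The frame components of the velocity are [exp (- z) * u], [exp z * v] and [w]; substituting
     [Hu] and [Hv] makes the first two visibly positive. *)
  exists (fun s => V1 * exp (z (s / n)) / n), (fun s => V2 * exp (- z (s / n)) / n),
    (fun s => w (s / n) / n), (fun s => y (s / n)).
  assert (He : forall s, 0 < exp s) by apply exp_pos.
  replace (0 / n) with 0 by (field; lra).
  assert (HS : sigma_curve (fun s => V1 * exp (z (s / n)) / n)
    (fun s => V2 * exp (- z (s / n)) / n) (fun s => w (s / n) / n)).
  { intros t. destruct (H (t / n)) as (_ & _ & Hz & _ & _ & Hw).
    rewrite Hu, Hv in Hw. unfold Rdiv in *.
    split; [ | split]; [derive_from_hyps; field; lra .. | ].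
    derive_from_hyps.
    replace (exp (2 * z (t * / n))) with (exp (z (t * / n)) ^ 2)
      by (simpl; rewrite Rmult_1_r, <- exp_plus; f_equal; ring).
    replace (exp (-2 * z (t * / n))) with (/ exp (z (t * / n)) ^ 2)
      by (rewrite <- pow_inv, <- exp_Ropp; simpl; rewrite Rmult_1_r, <- exp_plus;
          f_equal; ring).
    rewrite exp_Ropp. field. split; [lra | apply Rgt_not_eq, He]. }
  split; [exact HS | ]. split; [ | split; [ | split; [ | split; [ | split;
    [ | split; [ | split]]]]]].
  - intros t. apply Rdiv_lt_0_compat; [apply Rmult_lt_0_compat | ]; auto.
  - intros t. apply Rdiv_lt_0_compat; [apply Rmult_lt_0_compat | ]; auto.
  - rewrite Hz0, exp_0. field. lra.
  - rewrite Hz0, Ropp_0, exp_0. field. lra.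
  - rewrite Hw0. reflexivity.
  - intros t. destruct (H (t / n)) as (_ & Hy & _).
    rewrite Hv in Hy. unfold Rdiv in *.
    derive_from_hyps.
    rewrite Hz0, Ropp_0, exp_0.
    replace (exp (-2 * z (t * / n))) with (exp (- z (t * / n)) ^ 2)
      by (simpl; rewrite Rmult_1_r, <- exp_plus; f_equal; ring).
    field. lra.
  - exact Hy0.
  - rewrite <- Hy1. f_equal. field. lra.
Qed.

Theorem theorem6p1 :
  forall eps : R, 0 < eps ->
  exists L0 : R,
  forall (V1 V2 V3 c : R),
    positive3 V1 V2 V3 ->
    distinguished V1 V2 V3 ->
    in_loop_level_set (V1 / norm3 V1 V2 V3) (V2 / norm3 V1 V2 V3)
                      (V3 / norm3 V1 V2 V3) c ->
    L0 < loop_period c ->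
    forall a b c' : R, sol_exp V1 V2 V3 a b c' ->
    0 < b < 2 + eps.
Proof.
  intros eps Heps.
  (* The bound [eps / 10] absorbs the error [10 sqrt c]; the bound [/ 2] serves the period estimate
     and yields [c <= / 4]. *)
  set (d := Rmin (/ 2) (eps / 10)).
  assert (Hd : 0 < d <= / 2 /\ d <= eps / 10).
  { unfold d. pose proof (Rmin_l (/ 2) (eps / 10)).
    pose proof (Rmin_r (/ 2) (eps / 10)).
    repeat split; trivial. apply Rmin_glb_lt; lra. }
  exists (PI / d).
  intros V1 V2 V3 c HV [lam [Hlam [_ [[c1 [Hloop1 HT]] Hsym]]]] Hloop HL a b c' Hexp.
  pose proof HV as [HV1 [HV2 HV3]].
  destruct (sol_exp_flow _ _ _ _ _ _ HV Hexp)
    as (p & q & r & Y & H & Hp & Hq & Hp0 & Hq0 & Hr0 & HY & HY0 & HYn).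
  set (n := norm3 V1 V2 V3) in *.
  assert (Hn : 0 < n) by (apply sqrt_lt_R0; nra).
  unfold symmetric_flowline in Hsym.
  rewrite norm3_scale in Hloop1, HT, Hsym by lra. fold n in Hloop1, HT, Hsym.
  assert (Hcancel : forall x, lam * x / (lam * n) = x / n)
    by (intros; field; lra).
  rewrite !Hcancel in Hloop1. rewrite !Hcancel in Hsym.
  set (T := lam * n) in *.
  assert (HnT : n <= T) by (unfold T; nra).
  destruct Hloop as (Hc & Hunit & _ & _ & Hprod).
  destruct Hloop1 as (_ & _ & _ & _ & Hprod1).
  (* [V] and [lam V] have the same direction, hence the same level set. *)
  assert (c1 = c) as -> by lra.
  rewrite <- Hp0, <- Hq0, <- Hr0 in Hunit.
  rewrite <- Hp0, <- Hq0 in Hprod.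
  assert (Hsc : sqrt c < d).
  { apply Rnot_le_lt. intros Hle.
    pose proof (loop_period_le c d (proj1 Hd) Hle). lra. }
  assert (Hc4 : c <= / 4).
  { rewrite <- (pow2_sqrt c) by lra. pose proof (sqrt_pos c). nra. }
  (* Symmetry is given for some flow line from the same point; uniqueness carries it over to the one
     of the geodesic. *)
  assert (HT3 : p T = p 0 /\ q T = q 0 /\ r T = - r 0).
  { destruct Hsym as (P & Q & S & HS & HP0 & HQ0 & HS0 & HPT & HQT & HST).
    assert (E : P T = p T /\ Q T = q T /\ S T = r T)
      by (apply (sigma_unique p q r P Q S); trivial; lra).
    repeat split; lra. }
  destruct HT3 as (HpT & HqT & HrT).
  assert (HYpos : forall t, 0 < q t ^ 2 / q 0).
  { intros t. pose proof (Hq t). apply Rdiv_lt_0_compat; [nra | auto]. }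
  pose proof (is_derive_pos_lt Y _ 0 n Hn HY HYpos) as Hb.
  (* [b = Y n], and extending the flow line from [n] to [T = lam * n] only increases [Y]. *)
  assert (HYT : Y n <= Y T).
  { destruct HnT as [Hlt | Heq]; [ | rewrite <- Heq; lra].
    apply Rlt_le, (is_derive_pos_lt Y _ n T Hlt HY HYpos). }
  pose proof (Hq 0) as Hqpos.
  (* The factor [q 0] turns [Y' = q^2 / q 0] into the integrand [q^2]. *)
  assert (Hbound : q 0 * Y T - q 0 * Y 0 <= (2 + 10 * sqrt c) * q 0).
  { apply (symmetric_flow_bound p q r (fun t => q 0 * Y t) c T); trivial.
    - rewrite Hr0. now apply Rdiv_lt_0_compat.
    - intros t. rewrite (sigma_norm_const p q r H). exact Hunit.
    - intros t. rewrite (sigma_prod_const p q r H). exact Hprod.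
    - lra.
    - intros t. evar_last; [apply is_derive_scal, HY | ].
      field. lra. }
  assert (HYT2 : Y T <= 2 + 10 * sqrt c).
  { apply Rmult_le_reg_r with (q 0); trivial. rewrite HY0 in Hbound. lra. }
  lra.
Qed.
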